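(* Let $A, B \in \mathbb{R}^{n\times n}$ be such that $\min\{\operatorname{rank}(A), \operatorname{rank}(B)\} \leq 2$. Then the odd eigenvalues of $A\otimes B + B\otimes A$ interlace its even eigenvalues in each of the following cases: (i) $A$ and $B$ are symmetric matrices; (ii) $A$ and $B$ are skew-symmetric matrices.
   Context: All matrices are real and $\otimes$ is the Kronecker product. Let $T\in\mathbb{R}^{n^2\times n^2}$ be the commutation matrix, i.e. $T\operatorname{vec}(X)=\operatorname{vec}(X^\top)$ for all $X\in\mathbb{R}^{n\times n}$, where $\operatorname{vec}$ stacks columns. A vector $x\in\mathbb{R}^{n^2}$ is symmetric if $Tx=x$ and skew-symmetric if $Tx=-x$. For $A,B$ both symmetric or both skew-symmetric, $C:=A\otimes B+B\otimes A$ is a symmetric matrix commuting with $T$, so it has an orthonormal eigenbasis in which each eigenvector is either symmetric or skew-symmetric. The even eigenvalues of $C$ are its eigenvalues (with multiplicity) on the subspace of symmetric vectors, $\lambda_1\ge\cdots\ge\lambda_s$, $s=n(n+1)/2$; the odd eigenvalues are its eigenvalues (with multiplicity) on the subspace of skew-symmetric vectors, $\beta_1\ge\cdots\ge\beta_t$, $t=n(n-1)/2$. The odd eigenvalues of $C$ interlace its even eigenvalues if $\lambda_i\ge\beta_i\ge\lambda_{s-t+i}$ for all $i\in\{1,\dots,t\}$. *)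

(* Defs.v *)
From mathcomp Require Import all_boot all_order all_algebra.
From mathcomp Require Import polyrcf complex mxtens reals.

Set Implicit Arguments.
Unset Strict Implicit.
Unset Printing Implicit Defensive.

Import Order.TTheory GRing.Theory Num.Theory.
Local Open Scope ring_scope.

Section Commutation.
Variables (R : realType) (n : nat).

(* Column stacking: X i j sits at position j * n + i. *)
Definition vec (X : 'M[R]_n) : 'cV[R]_(n * n) :=
  \col_k X (mxtens_unindex k).2 (mxtens_unindex k).1.

Definition commutation_mx : 'M[R]_(n * n) :=
  \matrix_(k, l) (mxtens_unindex k
                    == ((mxtens_unindex l).2, (mxtens_unindex l).1))%:R.

Lemma commutation_mxE p (x : 'M[R]_(n * n, p)) (i j : 'I_n) k :
  (commutation_mx *m x) (mxtens_index (i, j)) k = x (mxtens_index (j, i)) k.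
Proof.
rewrite mxE (bigD1 (mxtens_index (j, i))) //= mxE !mxtens_indexK /= eqxx mul1r.
rewrite big1 ?addr0 // => l; case: (mxtens_indexP l) => a b ne.
rewrite mxE !mxtens_indexK /= xpair_eqE.
case: eqP => [ea|_]; last by rewrite mul0r.
case: eqP => [eb|_]; last by rewrite mul0r.
by rewrite ea eb eqxx in ne.
Qed.

Lemma commutation_mx_vec X : commutation_mx *m vec X = vec X^T.
Proof.
apply/matrixP => k z; case: (mxtens_indexP k) => i j.
by rewrite commutation_mxE !mxE !mxtens_indexK.
Qed.

Lemma commutation_mx_unique (T : 'M[R]_(n * n)) :
  (forall X, T *m vec X = vec X^T) -> T = commutation_mx.
Proof.
move=> hT; apply/trmx_inj/row_matrixP => l; rewrite -!tr_col; congr _^T.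
have E : forall M : 'M[R]_(n * n), col l M = M *m vec (\matrix_(i, j)
    (mxtens_index (j, i) == l)%:R).
  move=> M; rewrite colE; congr (_ *m _); apply/colP => k.
  by case: (mxtens_indexP k) => j i; rewrite !mxE mxtens_indexK /= andbT.
by rewrite !E hT commutation_mx_vec.
Qed.

Lemma trmx_commutation : commutation_mx^T = commutation_mx.
Proof.
apply/matrixP => k l; case: (mxtens_indexP k) => i j.
case: (mxtens_indexP l) => a b; rewrite !mxE !mxtens_indexK /= !xpair_eqE.
by rewrite [a == j]eq_sym [b == i]eq_sym andbC.
Qed.

Lemma commutation_mxK : commutation_mx *m commutation_mx = 1%:M.
Proof.
apply/matrixP => k l; case: (mxtens_indexP k) => i j.
rewrite commutation_mxE mxE !mxE !mxtens_indexK; congr (_%:R).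
case: (mxtens_indexP l) => a b; rewrite mxtens_indexK.
rewrite (can_eq (@mxtens_indexK _ _)) /= !xpair_eqE.
by rewrite andbC.
Qed.

Lemma tr_commutation_mx : \tr commutation_mx = n%:R.
Proof.
rewrite /mxtrace (reindex (@mxtens_index n n)) /=; last first.
  by exists (@mxtens_unindex n n) => i _; rewrite (mxtens_indexK, mxtens_unindexK).
under eq_bigr => p _ do rewrite mxE !mxtens_indexK.
rewrite -(pair_bigA _ (fun i j : 'I_n => ((i, j) == ((i,j).2, (i,j).1))%:R)) /=.
rewrite -[n in RHS]card_ord -sum1_card natr_sum; apply: eq_bigr => i _.
rewrite (bigD1 i) //= eqxx big1 ?addr0 // => j ne.
by rewrite xpair_eqE [i == j]eq_sym (negPf ne).
Qed.

End Commutation.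

Section SubspaceEigenvalues.
Variable R : realType.

(* Subspaces are row spaces, whose rows are transposes of column vectors; hence
   eigenspace M^T a is the space of all x with M *m x = a *: x.  Each eigenvalue a
   is repeated dim {x in V | M *m x = a *: x} times, in nonincreasing order
   (rootsR lists distinct roots increasingly); see size_eigenvalues_on. *)
Definition eigenvalues_on m p (M : 'M[R]_m) (V : 'M[R]_(p, m)) : seq R :=
  flatten [seq nseq (\rank (eigenspace M^T a :&: V)%MS) a
             | a <- rev (rootsR (char_poly M^T))].

Definition even_space n : 'M[R]_(n * n) := eigenspace (commutation_mx R n)^T 1.
Definition odd_space n : 'M[R]_(n * n) := eigenspace (commutation_mx R n)^T (-1).

Definition even_eigenvalues n (C : 'M[R]_(n * n)) : seq R :=
  eigenvalues_on C (even_space n).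
Definition odd_eigenvalues n (C : 'M[R]_(n * n)) : seq R :=
  eigenvalues_on C (odd_space n).

(* Indices are shifted by one: lambda`_0 and beta`_0 are the largest ones. *)
Definition odd_interlace_even n (C : 'M[R]_(n * n)) : Prop :=
  let s := ((n * n.+1)./2)%N in
  let t := ((n * n.-1)./2)%N in
  let lambda := even_eigenvalues C in
  let beta := odd_eigenvalues C in
  forall i : nat, (i < t)%N ->
    beta`_i <= lambda`_i /\ lambda`_(s - t + i) <= beta`_i.

Lemma even_spaceP n (x : 'cV[R]_(n * n)) :
  reflect (commutation_mx R n *m x = x) (x^T <= even_space n)%MS.
Proof.
apply: (iffP eigenspaceP) => [|e]; rewrite -trmx_mul scale1r.
  by move/trmx_inj.
by rewrite e.
Qed.

Lemma odd_spaceP n (x : 'cV[R]_(n * n)) :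
  reflect (commutation_mx R n *m x = - x) (x^T <= odd_space n)%MS.
Proof.
apply: (iffP eigenspaceP) => [|e]; rewrite -trmx_mul scaleN1r -linearN.
  by move/trmx_inj.
by rewrite e.
Qed.

Lemma sorted_eigenvalues_on m p (M : 'M[R]_m) (V : 'M[R]_(p, m)) :
  sorted >=%R (eigenvalues_on M V).
Proof.
rewrite /eigenvalues_on; set f := fun a => _.
have : sorted >%R (rev (rootsR (char_poly M^T))).
  by rewrite rev_sorted sorted_roots.
rewrite !sorted_pairwise; [|exact: rev_trans le_trans|exact: rev_trans lt_trans].
elim: (rev _) => //= a l IH /andP[/allP al /IH pl].
rewrite pairwise_cat pl andbT; apply/andP; split.
  apply/allrelP => x y /nseqP[-> _] /flatten_mapP[b /al ab /nseqP[-> _]].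
  exact: ltW.
rewrite /f; elim: (\rank (eigenspace M^T a :&: V)%MS) => //= k ->.
by rewrite andbT all_nseq /= lexx orbT.
Qed.

Lemma count_eigenvalues_on m p (M : 'M[R]_m) (V : 'M[R]_(p, m)) a :
  count_mem a (eigenvalues_on M V) = \rank (eigenspace M^T a :&: V)%MS.
Proof.
rewrite /eigenvalues_on count_flatten -map_comp.
have nz : char_poly M^T != 0 by rewrite monic_neq0 ?char_poly_monic.
have -> : [seq (count_mem a \o (fun b => nseq (\rank (eigenspace M^T b :&: V)%MS) b)) i
    | i <- rev (rootsR (char_poly M^T))] = [seq ((i == a) *
      \rank (eigenspace M^T a :&: V)%MS)%N | i <- rev (rootsR (char_poly M^T))].
  by apply: eq_map => b /=; rewrite count_nseq /=; case: eqP => // ->.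
rewrite sumnE big_map -big_distrl /= -big_mkcond /= sum1_count.
rewrite (count_uniq_mem _ _) ?rev_uniq ?uniq_roots // mem_rev.
have := roots_on_rootsR nz a; rewrite in_itv /= => <-.
rewrite -eigenvalue_root_char; case: (boolP (eigenvalue _ _)) => [_|]; first by rewrite mul1n.
rewrite mul0n negbK => /eqP E; apply/esym/eqP; rewrite mxrank_eq0 -submx0 -E; exact: capmxSl.
Qed.

Lemma symmetric_diagonalizable m (M : 'M[R]_m) :
  M^T = M -> diagonalizable M.
Proof.
case: m M => [|m] M symM.
  by rewrite (thinmx0 M); exact: diagonalizable0.
apply/diagonalizableP.
pose f := real_complex R; pose M' := map_mx f M.
have hM : M' \is hermsymmx.
  apply: realsym_hermsym.
    apply/is_hermitianmxP/matrixP => i j; rewrite expr0 !mxE mul1r.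
    by rewrite -[in LHS]symM mxE.
  by apply/mxOverP => i j; rewrite mxE; apply/complex_realP; exists (M i j).
have dreal := hermitian_spectral_diag_real hM.
have /orthomx_spectralP := hermitian_normalmx hM.
set P := spectralmx _; set d := spectral_diag _ => eM.
have Pu : P \in unitmx := spectral_unit _.
have eM' : M' = conjmx (invmx P) (diag_mx d).
  by rewrite conjumx ?unitmx_inv // invmxK.
have E : mxminpoly M' = \prod_(r <- undup [seq d 0 i | i <- enum 'I_m.+1])
    ('X - r%:P).
  by rewrite eM' mxminpoly_uconj ?unitmx_inv // mxminpoly_diag.
exists (map (@complex.Re R) (undup [seq d 0 i | i <- enum 'I_m.+1])).
  rewrite map_inj_in_uniq ?undup_uniq // => x y.
  rewrite !mem_undup => /mapP[i _ ->] /mapP[j _ ->].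
  have /complex_realP[a ->] := mxOverP dreal 0 i.
  by have /complex_realP[b ->] := mxOverP dreal 0 j => /= ->.
rewrite -(dvdp_map f) -mxminpoly_map -/M' E rmorph_prod big_map.
rewrite (eq_big_seq (fun r => map_poly f ('X - (complex.Re r)%:P))) //.
move=> x; rewrite mem_undup => /mapP[i _ ->].
have /complex_realP[a ->] := mxOverP dreal 0 i.
by rewrite rmorphB /= map_polyX map_polyC.
Qed.

Lemma size_eigenvalues_on m (M V P : 'M[R]_m) :
  M^T = M -> (V :=: P)%MS -> P *m P = P -> P *m M = M *m P ->
  size (eigenvalues_on M V) = \rank V.
Proof.
move=> symM eV PP PM.
rewrite /eigenvalues_on symM size_flatten /shape -map_comp sumnE big_map.
set r := rev _.
under eq_bigr => a _ do rewrite /= size_nseq.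
have ur : uniq r by rewrite rev_uniq uniq_roots.
have nz : char_poly M != 0 by rewrite monic_neq0 ?char_poly_monic.
have full : (1%:M <= \sum_(a <- r) eigenspace M a)%MS.
  have /diagonalizablePeigen[rs _ ers] := symmetric_diagonalizable symM.
  rewrite -ers {ers}.
  elim: (rs) => [|a l IH]; first by rewrite big_nil sub0mx.
  rewrite big_cons addsmx_sub IH andbT.
  have [ev|] := boolP (eigenvalue M a); last by rewrite negbK => /eqP->; exact: sub0mx.
  have ar : a \in r.
    rewrite mem_rev -(roots_on_rootsR nz a) in_itv /=.
    by rewrite -eigenvalue_root_char.
  by rewrite (bigD1_seq a) //= addsmxSl.
rewrite (big_nth 0) big_mkord in full.
rewrite (big_nth 0) big_mkord.
have dir0 : mxdirect (\sum_(i < size r) eigenspace M r`_i).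
  apply: mxdirect_sum_eigenspace => i j _ _ rsij; apply/val_inj.
  by apply: uniqP rsij; rewrite ?inE.
have dir : mxdirect (\sum_(i < size r) (eigenspace M r`_i :&: V)%MS).
  apply/mxdirect_sumsP => i _; apply/eqP; rewrite -submx0.
  have /mxdirect_sumsP/(_ i isT) dir0i := dir0; rewrite -[X in (_ <= X)%MS]dir0i.
  apply: capmxS; first exact: capmxSl.
  by apply/sumsmx_subP => j ji; apply: (sumsmx_sup j) => //; exact: capmxSl.
rewrite -(mxdirectP dir) /=; apply/eqP; rewrite eqn_leq.
apply/andP; split; apply: mxrankS.
  by apply/sumsmx_subP => i _; exact: capmxSr.
rewrite eV -[X in (X <= _)%MS]mul1mx; apply: (submx_trans (submxMr P full)).
rewrite sumsmxMr; apply/sumsmx_subP => i _; apply: (sumsmx_sup i) => //.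
rewrite sub_capmx eV submxMl andbT; apply/eigenspaceP.
rewrite -mulmxA PM mulmxA (eigenspaceP (submx_refl _)).
by rewrite scalemxAl.
Qed.

Lemma rank_idempotent m (P : 'M[R]_m) : P *m P = P -> (\rank P)%:R = \tr P.
Proof.
move=> PP.
have [r [c [fr fc cr]]] : exists (r : 'M_(\rank P, m)) (c : 'M_(m, \rank P)),
    [/\ row_free r, row_full c & c *m r = P].
  exists (row_base P), (col_base P).
  by split; [exact: row_base_free|exact: col_base_full|exact: mulmx_base].
rewrite -[in RHS]cr mxtrace_mulC.
suff -> : r *m c = 1%:M :> 'M_(\rank P) by rewrite mxtrace1.
apply: (row_free_inj fr); apply: (row_full_inj fc) => /=.
by rewrite mul1mx !mulmxA cr -mulmxA cr PP.
Qed.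

Section Sizes.
Variable n : nat.
Local Notation T := (commutation_mx R n).
Local Notation proj e := (2^-1 *: (1%:M + e *: T)).

Let proj_idempotent (e : R) : e * e = 1 -> proj e *m proj e = proj e.
Proof.
move=> ee; set S := e *: T.
have SS : S *m S = 1%:M.
  by rewrite -scalemxAl -scalemxAr commutation_mxK scalerA ee scale1r.
rewrite -scalemxAl -scalemxAr mulmxDl !mulmxDr !mul1mx mulmx1 SS.
rewrite [S + _]addrC -mulr2n -scaler_nat.
by rewrite [X in _ *: X]scalerA mulVf ?pnatr_eq0 // scale1r.
Qed.

Let eigenspace_proj (e : R) : e * e = 1 -> (eigenspace T^T e :=: proj e)%MS.
Proof.
move=> ee; rewrite trmx_commutation; apply/eqmxP/andP; split.
  have E : eigenspace T e *m (1%:M + e *: T) = 2 *: eigenspace T e.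
    rewrite mulmxDr mulmx1 -scalemxAr (eigenspaceP (submx_refl _)).
    by rewrite scalerA ee scale1r scaler_nat mulr2n.
  apply/submxP; exists (eigenspace T e).
  by rewrite -scalemxAr E scalerA mulVf ?pnatr_eq0 // scale1r.
apply/eigenspaceP.
rewrite -scalemxAl mulmxDl mul1mx -scalemxAl commutation_mxK.
rewrite [RHS]scalerA mulrC -scalerA; congr (_ *: _).
by rewrite scalerDr scalerA ee scale1r addrC.
Qed.

Let rank_proj (e : R) :
  e * e = 1 -> (\rank (proj e))%:R * 2 = n%:R * n%:R + e * n%:R.
Proof.
move=> ee; rewrite rank_idempotent; last exact: proj_idempotent.
rewrite mxtraceZ mxtraceD mxtraceZ mxtrace1 tr_commutation_mx natrM.
by rewrite mulrC mulrA mulfV ?pnatr_eq0 // mul1r.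
Qed.

Let size_eigenspace (C : 'M[R]_(n * n)) (e : R) :
  e * e = 1 -> C^T = C -> T *m C = C *m T ->
  (size (eigenvalues_on C (eigenspace T^T e)))%:R * 2
    = n%:R * n%:R + e * n%:R :> R.
Proof.
move=> ee symC TC; rewrite -rank_proj //.
have eV := eigenspace_proj ee.
rewrite (size_eigenvalues_on symC eV) ?eV ?proj_idempotent //.
rewrite -scalemxAl -scalemxAr mulmxDl mulmxDr mul1mx mulmx1.
by rewrite -scalemxAl -scalemxAr TC.
Qed.

Lemma size_even_eigenvalues (C : 'M[R]_(n * n)) :
  C^T = C -> T *m C = C *m T -> size (even_eigenvalues C) = ((n * n.+1)./2)%N.
Proof.
move=> symC TC; have := size_eigenspace (mulr1 1) symC TC.
rewrite mul1r -!natrM -natrD => /eqP; rewrite eqr_nat -/(even_space n) => /eqP E.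
by rewrite mulnS addnC -E muln2 doubleK.
Qed.

Lemma size_odd_eigenvalues (C : 'M[R]_(n * n)) :
  C^T = C -> T *m C = C *m T -> size (odd_eigenvalues C) = ((n * n.-1)./2)%N.
Proof.
move=> symC TC; have /eqP := size_eigenspace (etrans (mulrNN 1 1) (mulr1 1)) symC TC.
rewrite mulN1r eq_sym subr_eq -!natrM -natrD eqr_nat.
rewrite -/(odd_space n) => /eqP E.
have -> : (n * n.-1 = (size (odd_eigenvalues C)).*2)%N; last by rewrite doubleK.
by rewrite -subn1 mulnBr muln1 E addnK muln2.
Qed.

End Sizes.

Lemma trmx_kron_sym n (A B : 'M[R]_n) :
  (A^T = A /\ B^T = B) \/ (A^T = - A /\ B^T = - B) ->
  (A *t B + B *t A)^T = A *t B + B *t A.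
Proof.
rewrite linearD /= !trmx_tens => -[] [-> ->] //.
by congr (_ + _); apply/matrixP => k l; rewrite !mxE mulrNN.
Qed.

Lemma commutation_kron_sym n (A B : 'M[R]_n) :
  commutation_mx R n *m (A *t B + B *t A)
    = (A *t B + B *t A) *m commutation_mx R n.
Proof.
apply/matrixP => k l; case: (mxtens_indexP k) => i j.
case: (mxtens_indexP l) => a b.
rewrite commutation_mxE -[(A *t B + B *t A) *m _]trmxK trmx_mul trmx_commutation.
rewrite [RHS]mxE commutation_mxE.
by rewrite !mxE !mxtens_indexK /= addrC mulrC [X in _ + X]mulrC.
Qed.

End SubspaceEigenvalues.

(* Main.v *)
(* On symmetric and on skew-symmetric matrices X the quadratic form of
   A (x) B + B (x) A at vec X is 2 tr(X^T A X B^T).  By symmetry in A and B we may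
   assume rank A <= 2.  In suitable orthonormal coordinates A vanishes outside its
   leading 2 x 2 block S, so the form only depends on the first two rows of X, and
   it is unchanged when these are multiplied by an orthogonal K with K^T S K = S.
   If moreover K has trace zero, then K J is symmetric for the skew 2 x 2 matrix J,
   so K X can be completed to a symmetric matrix, with the same norm as X, by
   reflecting the off-diagonal block and flipping signs in the remaining one.  This
   isometrically embeds the skew-symmetric matrices into the symmetric ones while
   preserving the form, and a Courant-Fischer dimension count gives interlacing. *)
Require Import Defs.
From mathcomp Require Import all_boot all_order all_algebra.
From mathcomp Require Import mxtens reals.
Local Open Scope ring_scope.
From HB Require Import structures.
From mathcomp Require Import polyrcf ring lra zify.
Import Order.TTheory GRing.Theory Num.Theory.

(** * Linear maps as matrices and squared norms of row vectors *)

Lemma linear_mx {R : realType} {m p : nat} (f : 'rV[R]_m -> 'rV[R]_p) :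
  linear f -> exists F : 'M[R]_(m, p), forall u, f u = u *m F.
Proof.
move=> lf; pose g : {linear 'rV[R]_m -> 'rV[R]_p} :=
  HB.pack f (GRing.isLinear.Build R 'rV[R]_m 'rV[R]_p *:%R f lf).
by exists (lin1_mx g) => u; rewrite (mul_rV_lin1 g).
Qed.

Lemma dot_ge0 {R : realType} {m : nat} (x : 'rV[R]_m) : 0 <= (x *m x^T) 0 0.
Proof. by rewrite mxE sumr_ge0 // => i _; rewrite mxE -expr2 sqr_ge0. Qed.

Lemma dot_eq0 {R : realType} {m : nat} (x : 'rV[R]_m) :
  ((x *m x^T) 0 0 == 0) = (x == 0).
Proof.
apply/idP/eqP => [|->]; last by rewrite mul0mx mxE.
rewrite mxE psumr_eq0 => [/allP h|i _]; last by rewrite mxE -expr2 sqr_ge0.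
apply/rowP => i; have := h i (mem_index_enum i).
by rewrite !mxE mulf_eq0 orbb => /eqP.
Qed.

Lemma dot_gt0 {R : realType} {m : nat} (x : 'rV[R]_m) :
  x != 0 -> 0 < (x *m x^T) 0 0.
Proof. by rewrite -dot_eq0 lt0r dot_ge0 andbT. Qed.

(** * Spectral subspaces and their quadratic forms *)

(** Spectral subspaces for the Courant-Fischer argument. Selecting by a predicate on eigenvalues,
    not by index, avoids choosing eigenvectors within a multiple eigenvalue. *)
Definition eigensum {R : realType} {m p : nat} (M : 'M[R]_m) (V : 'M[R]_(p, m))
    (P : pred R) : 'M[R]_m :=
  (\sum_(a <- rev (rootsR (char_poly M^T)) | P a) (eigenspace M^T a :&: V))%MS.

Lemma eigensum_sub {R : realType} {m p : nat} (M : 'M[R]_m) (V : 'M[R]_(p, m))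
    (P : pred R) :
  (eigensum M V P <= V)%MS.
Proof.
rewrite /eigensum; elim: (rev _) => [|a l IH]; first by rewrite big_nil sub0mx.
by rewrite big_cons; case: ifP => // _; rewrite addsmx_sub capmxSr.
Qed.

(** Eigenspaces for distinct eigenvalues form a direct sum, so ranks add up to the multiplicities in
    [eigenvalues_on]. *)
Lemma mxrank_eigensum {R : realType} {m p : nat} (M : 'M[R]_m)
    (V : 'M[R]_(p, m)) (P : pred R) :
  \rank (eigensum M V P) = count P (eigenvalues_on M V).
Proof.
rewrite /eigenvalues_on /eigensum.
have ur : uniq (rev (rootsR (char_poly M^T))) by rewrite rev_uniq uniq_roots.
move: (rev _) ur => r ur.
rewrite (big_nth 0) big_mkord.
have dir0 : mxdirect (\sum_(i < size r) eigenspace M^T r`_i).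
  apply: mxdirect_sum_eigenspace => i j _ _ rsij; apply/val_inj.
  by apply: uniqP rsij; rewrite ?inE.
have dir : mxdirect (\sum_(i < size r | P r`_i) (eigenspace M^T r`_i :&: V)%MS).
  apply/mxdirect_sumsP => i Pi; apply/eqP; rewrite -submx0.
  have /mxdirect_sumsP/(_ i isT) dir0i := dir0; rewrite -[X in (_ <= X)%MS]dir0i.
  apply: capmxS; first exact: capmxSl.
  apply/sumsmx_subP => j /andP[_ ji].
  by apply: (sumsmx_sup j) => //; exact: capmxSl.
rewrite (mxdirectP dir) /=.
rewrite -(big_mkord (fun i => P r`_i) (fun i => \rank (eigenspace M^T r`_i :&: V)%MS)).
rewrite -(big_nth 0 P (fun a => \rank (eigenspace M^T a :&: V)%MS)).
elim: r {ur dir0 dir} => [|a r IH]; first by rewrite big_nil.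
by rewrite big_cons IH /= count_cat count_nseq; case: (P a); rewrite ?mul1n.
Qed.

(** Eigenvectors of a symmetric matrix for distinct eigenvalues are orthogonal, so the expression
    splits into terms [c * (a - mu)] times a squared norm. The factor [c] covers lower and upper
    bounds at once. *)
Lemma eigensum_form {R : realType} {m p : nat} (M : 'M[R]_m) (V : 'M[R]_(p, m))
    (P : pred R) (x : 'rV[R]_m) (c mu : R) :
  M^T = M -> (x <= eigensum M V P)%MS ->
  (forall a, P a -> 0 <= c * (a - mu)) ->
  0 <= c * ((x *m M *m x^T) 0 0 - mu * (x *m x^T) 0 0).
Proof.
move=> sM; rewrite /eigensum sM => xP Pc.
have ur : uniq (rev (rootsR (char_poly M))) by rewrite rev_uniq uniq_roots.
move: (rev _) ur xP => r ur; rewrite (big_nth 0) big_mkord.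
case/sub_sumsmxP => v ->.
pose u := fun i : 'I_(size r) => v i *m (eigenspace M r`_i :&: V)%MS.
have eu i : u i *m M = r`_i *: u i.
  by apply/eigenspaceP/(submx_trans (submxMl _ _))/capmxSl.
rewrite (eq_bigr u) //; clearbody u.
have orth i j : j != i -> u i *m (u j)^T = 0.
  move=> ji; have: r`_i *: (u i *m (u j)^T) = r`_j *: (u i *m (u j)^T).
    by rewrite scalemxAl -eu -mulmxA -[in LHS]sM -trmx_mul eu linearZ /= scalemxAr.
  move/eqP; rewrite -subr_eq0 -scalerBl scaler_eq0 subr_eq0 nth_uniq //.
  by rewrite -[(i : nat) == j]/(i == j) [i == j]eq_sym (negPf ji) => /eqP.
(* Used with [d] the eigenvalues for the form, and with [d] equal to 1 for the squared norm. *)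
have E (d : 'I_(size r) -> R) : (\sum_(i < size r | P r`_i) d i *: u i) *m
      (\sum_(i < size r | P r`_i) u i)^T =
    \sum_(i < size r | P r`_i) d i *: (u i *m (u i)^T).
  rewrite linear_sum mulmx_suml; apply: eq_bigr => i Pi.
  rewrite mulmx_sumr (bigD1 i) //= big1 ?addr0 ?scalemxAl // => j /andP[_ ji].
  by rewrite -scalemxAl orth ?scaler0.
have E1 : (\sum_(i < size r | P r`_i) u i) *m (\sum_(i < size r | P r`_i) u i)^T =
    \sum_(i < size r | P r`_i) u i *m (u i)^T.
  under [RHS]eq_bigr do rewrite -[_ *m _]scale1r.
  by rewrite -E; under [in RHS]eq_bigr do rewrite scale1r.
have uM : (\sum_(i < size r | P r`_i) u i) *m M =
    \sum_(i < size r | P r`_i) r`_i *: u i.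
  by rewrite mulmx_suml; apply: eq_bigr => i _; rewrite eu.
rewrite uM E E1 !summxE mulr_sumr -sumrB mulr_sumr sumr_ge0 // => i Pi.
rewrite mxE -mulrBl mulrA.
by rewrite mulr_ge0 ?dot_ge0 ?Pc.
Qed.

(** * Counting in nonincreasing lists and intersecting subspaces *)

Lemma count_sorted_ge {R : realType} (l : seq R) (i : nat) :
  sorted >=%R l -> (i < size l)%N -> (i < count (fun a => l`_i <= a)%R l)%N.
Proof.
move=> sl il; rewrite -[X in count _ X](cat_take_drop i.+1 l) count_cat.
have -> : count (fun a => l`_i <= a) (take i.+1 l) = i.+1.
  transitivity (size (take i.+1 l)); last by rewrite size_take_min; apply/minn_idPl.
  apply/eqP; rewrite -all_count; apply/(all_nthP 0) => j.
  rewrite size_take_min leq_min => /andP[ji jl]; rewrite nth_take //.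
  exact: (sorted_leq_nth (rev_trans le_trans) (@lexx _ _) 0 sl).
exact: leq_addr.
Qed.

Lemma count_sorted_le {R : realType} (l : seq R) (i : nat) :
  sorted >=%R l -> (size l - i <= count (fun a => a <= l`_i)%R l)%N.
Proof.
move=> sl; rewrite -[X in (_ <= count _ X)%N](cat_take_drop i l) count_cat.
have -> : count (fun a => a <= l`_i) (drop i l) = (size l - i)%N.
  rewrite -size_drop; apply/eqP; rewrite -all_count; apply/(all_nthP 0) => j.
  rewrite size_drop nth_drop ltn_subRL => jl.
  apply: (sorted_leq_nth (rev_trans le_trans) (@lexx _ _) 0 sl) => //.
  - exact: leq_ltn_trans (leq_addr j i) jl.
  - exact: leq_addr.
exact: leq_addl.
Qed.

(** Grassmann's dimension formula inside [W]. *)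
Lemma capmx_neq0 {R : realType} {m p q r : nat} (U : 'M[R]_(p, m))
    (V : 'M[R]_(q, m)) (W : 'M[R]_(r, m)) :
  (U <= W)%MS -> (V <= W)%MS -> (\rank W < \rank U + \rank V)%N ->
  exists2 x : 'rV[R]_m, x != 0 & (x <= U)%MS /\ (x <= V)%MS.
Proof.
move=> UW VW rk.
have /rowV0Pn[x xUV x0] : (U :&: V)%MS != 0.
  rewrite -mxrank_eq0; have := mxrank_sum_cap U V.
  have : (\rank (U + V)%MS <= \rank W)%N by rewrite mxrankS // addsmx_sub UW.
  lia.
by exists x => //; apply/andP; rewrite -sub_capmx.
Qed.

(** * Interlacing from an isometric embedding that preserves the form *)

Section IsometricEmbedding.
Context {R : realType} {m : nat} (C V W F : 'M[R]_m).
Hypothesis symC : C^T = C.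
Hypothesis FV : (W *m F <= V)%MS.
Hypothesis isoF : forall x : 'rV[R]_m, (x <= W)%MS ->
  ((x *m F) *m (x *m F)^T) 0 0 = (x *m x^T) 0 0.
Hypothesis formF : forall x : 'rV[R]_m, (x <= W)%MS ->
  ((x *m F) *m C *m (x *m F)^T) 0 0 = (x *m C *m x^T) 0 0.

(* With c = 1 (c = -1) P selects eigenvalues above (below) nu and Q those below
   (above) mu. *)
Lemma count_isometric_embedding (P Q : pred R) (c mu nu : R) :
  0 < c * (nu - mu) ->
  (forall a, P a -> 0 <= c * (a - nu)) -> (forall a, Q a -> 0 <= - c * (a - mu)) ->
  (count P (eigenvalues_on C W) + count Q (eigenvalues_on C V) <= \rank V)%N.
Proof.
move=> munu hP hQ; rewrite -!mxrank_eigensum leqNgt; apply/negP => rk.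
(* An isometry kills no nonzero vector, so [F] keeps the dimension of the spectral subspace of
   [W]. *)
have rF : \rank (eigensum C W P *m F) = \rank (eigensum C W P).
  apply/mxrank_injP; rewrite -submx0; apply/rV_subP => x.
  rewrite sub_capmx => /andP[xP /sub_kermxP xF].
  have := isoF x (submx_trans xP (eigensum_sub _ _ _)).
  rewrite xF mul0mx mxE => /esym/eqP.
  by rewrite dot_eq0 => /eqP->; rewrite sub0mx.
(* Too large a count forces a nonzero [y] in the image of the first spectral subspace and in the
   second one. *)
rewrite -rF in rk.
have [y y0 [yF yQ]] := capmx_neq0 _ _ _
  (submx_trans (submxMr F (eigensum_sub C W P)) FV) (eigensum_sub C V Q) rk.
have [z zE] := submxP yF; rewrite mulmxA in zE.
move: (submxMl z (eigensum C W P)) zE.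
move: (z *m _) => x xP zE.
have xW := submx_trans xP (eigensum_sub _ _ _).
(* Form and norm at [y] are those at its preimage [x]; adding both inequalities bounds
   [c * (nu - mu)] times the squared norm of [x] by 0. *)
have := eigensum_form _ _ _ _ _ _ symC xP hP.
have := eigensum_form _ _ _ _ _ _ symC yQ hQ.
have := dot_gt0 _ y0; rewrite zE isoF // formF // => x0.
move: (mulr_gt0 munu x0).
move: ((x *m x^T) 0 0) ((x *m C *m x^T) 0 0) => s t; lra.
Qed.

(** A violated inequality makes the two counts add up to at least [\rank V + 1]: [i + 1] on [W] and
    [\rank V - i] on [V] for the first, [\rank W - i] on [W] and [j + 1] on [V] for the second. *)
Lemma interlace_isometric_embedding (i : nat) :
  size (eigenvalues_on C V) = \rank V -> size (eigenvalues_on C W) = \rank W ->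
  (\rank W <= \rank V)%N -> (i < \rank W)%N ->
  (eigenvalues_on C W)`_i <= (eigenvalues_on C V)`_i /\
  (eigenvalues_on C V)`_(\rank V - \rank W + i) <= (eigenvalues_on C W)`_i.
Proof.
move=> sV sW WV iW; have soV := sorted_eigenvalues_on C V.
have soW := sorted_eigenvalues_on C W.
split; rewrite leNgt; apply/negP => lt.
  have : (count (fun a => (eigenvalues_on C W)`_i <= a)%R (eigenvalues_on C W) +
      count (fun a => a <= (eigenvalues_on C V)`_i)%R (eigenvalues_on C V)
      <= \rank V)%N.
    apply: (count_isometric_embedding _ _ 1 (eigenvalues_on C V)`_i
      (eigenvalues_on C W)`_i) => [|a|a]; lra.
  have := count_sorted_ge _ i soW; have := count_sorted_le _ i soV.
  by rewrite sV sW => h1 /(_ iW) h2; lia.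
set j := (_ + i)%N in lt *.
have : (count (fun a => a <= (eigenvalues_on C W)`_i)%R (eigenvalues_on C W) +
    count (fun a => (eigenvalues_on C V)`_j <= a)%R (eigenvalues_on C V)
    <= \rank V)%N.
  apply: (count_isometric_embedding _ _ (-1) (eigenvalues_on C V)`_j
    (eigenvalues_on C W)`_i) => [|a|a]; lra.
have := count_sorted_le _ i soW; have := count_sorted_ge _ j soV.
have jV : (j < \rank V)%N by rewrite /j; lia.
by rewrite sV sW => /(_ jV) h1 h2; move: WV iW h1 h2; rewrite /j; lia.
Qed.
End IsometricEmbedding.

(** * Orthonormal families *)

Lemma exists_orthonormal_rows {R : realType} {m p : nat} (V : 'M[R]_(p, m))
    (k : nat) :
  (k <= \rank V)%N -> exists2 U : 'M[R]_(k, m), U *m U^T = 1%:M & (U <= V)%MS.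
Proof.
elim: k => [|k IH] kV.
  by exists 0; [apply/matrixP => - [] | exact: sub0mx].
have [U UU UV] := IH (ltnW kV).
have [x x0 [xV]] : exists2 x : 'rV[R]_m, x != 0 &
    (x <= V)%MS /\ (x <= kermx U^T)%MS.
  (* [V] has dimension at least [k + 1] and the orthogonal complement of [U] at least [m - k], too
     much for the whole space. *)
  apply: (@capmx_neq0 _ _ _ _ _ _ _ 1%:M); rewrite ?submx1 // mxrank1 mxrank_ker.
  by have := rank_leq_col V; have := rank_leq_col U^T; lia.
move=> xU0; have xU := sub_kermxP xU0; have x_gt0 := dot_gt0 _ x0.
pose y := (Num.sqrt ((x *m x^T) 0 0))^-1 *: x.
have yU : y *m U^T = 0 by rewrite -scalemxAl xU scaler0.
have yy : y *m y^T = 1%:M.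
  rewrite linearZ /= -scalemxAl -scalemxAr scalerA -invfM -expr2 sqr_sqrtr ?ltW //.
  by rewrite [X in _ *: X]mx11_scalar scale_scalar_mx mulVf ?gt_eqF.
rewrite -addn1; exists (col_mx U y).
  rewrite tr_col_mx mul_col_row UU yU yy -[U *m y^T]trmxK trmx_mul trmxK yU trmx0.
  by rewrite -scalar_mx_block.
by rewrite col_mx_sub UV scalemx_sub.
Qed.

(** * From skew-symmetric to symmetric matrices *)

(** Flipping signs strictly below the diagonal turns a skew-symmetric matrix, whose diagonal is
    zero, into a symmetric one of the same Frobenius norm. *)
Definition signed_sym {R : realType} {p : nat} (Z : 'M[R]_p) : 'M[R]_p :=
  \matrix_(i, j) ((-1) ^+ (j < i)%N * Z i j).

Lemma trmx_signed_sym {R : realType} {p : nat} (Z : 'M[R]_p) :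
  Z^T = - Z -> (signed_sym Z)^T = signed_sym Z.
Proof.
move=> sZ; apply/matrixP => i j; rewrite !mxE.
have : Z^T i j = - Z i j by rewrite sZ mxE.
rewrite mxE => ->.
case: (ltngtP i j) => [||/val_inj ->] /=; rewrite ?expr0 ?expr1; try lra.
have : Z^T j j = - Z j j by rewrite sZ mxE.
rewrite mxE; lra.
Qed.

Lemma mxtrace_tr_mulmx {R : realType} {m p : nat} (X Y : 'M[R]_(m, p)) :
  \tr (X^T *m Y) = \sum_j \sum_i X i j * Y i j.
Proof. by apply: eq_bigr => j _; rewrite mxE; apply: eq_bigr => i _; rewrite mxE. Qed.

Lemma norm_signed_sym {R : realType} {p : nat} (Z : 'M[R]_p) :
  \tr ((signed_sym Z)^T *m signed_sym Z) = \tr (Z^T *m Z).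
Proof.
rewrite !mxtrace_tr_mulmx; apply: eq_bigr => j _; apply: eq_bigr => i _.
by rewrite mxE mulrACA -expr2 sqrr_sign mul1r.
Qed.

Section SkewToSym.
Context {R : realType} {m : nat} (K : 'M[R]_2).
Hypothesis orthK : K^T *m K = 1%:M.
Hypothesis symK : forall Y : 'M[R]_2, Y^T = - Y -> (K *m Y)^T = K *m Y.

Definition skew_to_sym (Y : 'M[R]_(2 + m)) : 'M[R]_(2 + m) :=
  block_mx (K *m ulsubmx Y) (K *m ursubmx Y) (K *m ursubmx Y)^T
    (signed_sym (drsubmx Y)).

Lemma skew_to_sym_linear c (X Y : 'M[R]_(2 + m)) :
  skew_to_sym (c *: X + Y) = c *: skew_to_sym X + skew_to_sym Y.
Proof.
rewrite /skew_to_sym scale_block_mx add_block_mx; congr block_mx.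
- by rewrite /ulsubmx !linearP.
- by rewrite /ursubmx !linearP.
- by rewrite /ursubmx !linearP.
- by apply/matrixP => i j; rewrite !mxE; ring.
Qed.

Lemma usubmx_skew_to_sym (Y : 'M[R]_(2 + m)) :
  usubmx (skew_to_sym Y) = K *m usubmx Y.
Proof.
rewrite /skew_to_sym block_mxEv col_mxKu -mul_mx_row; congr (_ *m _).
by rewrite hsubmxK.
Qed.

Lemma skew_blocks (Y : 'M[R]_(2 + m)) : Y^T = - Y ->
  [/\ (ulsubmx Y)^T = - ulsubmx Y, dlsubmx Y = - (ursubmx Y)^T &
   (drsubmx Y)^T = - drsubmx Y].
Proof.
move=> sY; split; apply/matrixP => i j; rewrite !mxE.
- have : Y^T (lshift _ i) (lshift _ j) = - Y (lshift _ i) (lshift _ j).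
    by rewrite sY mxE.
  by rewrite mxE.
- have : Y^T (lshift _ j) (rshift _ i) = - Y (lshift _ j) (rshift _ i).
    by rewrite sY mxE.
  by rewrite mxE.
- have : Y^T (rshift _ i) (rshift _ j) = - Y (rshift _ i) (rshift _ j).
    by rewrite sY mxE.
  by rewrite mxE.
Qed.

Lemma trmx_skew_to_sym (Y : 'M[R]_(2 + m)) :
  Y^T = - Y -> (skew_to_sym Y)^T = skew_to_sym Y.
Proof.
move=> /skew_blocks[s1 _ s3].
by rewrite /skew_to_sym tr_block_mx symK // trmxK trmx_signed_sym.
Qed.

Lemma norm_block (X1 : 'M[R]_2) X2 X3 (X4 : 'M[R]_m) (X := block_mx X1 X2 X3 X4) :
  \tr (X^T *m X) = \tr (X1^T *m X1) + \tr (X2^T *m X2)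
     + (\tr (X3^T *m X3) + \tr (X4^T *m X4)).
Proof.
rewrite /X tr_block_mx mulmx_block mxtrace_block !mxtraceD.
by rewrite addrACA.
Qed.

(** The orthogonal [K] preserves the norms of the upper blocks, and in a skew-symmetric [Y] the
    lower left block has the norm of the upper right one. *)
Lemma norm_skew_to_sym (Y : 'M[R]_(2 + m)) : Y^T = - Y ->
  \tr ((skew_to_sym Y)^T *m skew_to_sym Y) = \tr (Y^T *m Y).
Proof.
move=> /skew_blocks[_ s2 _].
have nK p (Z : 'M[R]_(2, p)) : \tr ((K *m Z)^T *m (K *m Z)) = \tr (Z^T *m Z).
  by rewrite trmx_mul mulmxA -(mulmxA _ K^T) orthK mulmx1.
rewrite -[in RHS](submxK Y) !norm_block norm_signed_sym s2 !nK.
rewrite [\tr ((K *m ursubmx Y)^T^T *m _)]mxtrace_mulC trmxK nK.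
rewrite [(- _)^T]linearN /= mulNmx mulmxN opprK trmxK.
by rewrite [\tr (ursubmx Y *m _)]mxtrace_mulC.
Qed.
End SkewToSym.

(* For symmetric S, K is a reflection along eigenvectors of S; for skew S, it is
   the rotation by a right angle. *)
Lemma exists_orthogonal_twist {R : realType} (S : 'M[R]_2) :
  S^T = S \/ S^T = - S ->
  exists K : 'M[R]_2, [/\ K^T *m K = 1%:M,
    forall Y : 'M[R]_2, Y^T = - Y -> (K *m Y)^T = K *m Y &
    K^T *m S *m K = S].
Proof.
pose M2 (a b c d : R) : 'M[R]_2 := 
  \matrix_(i, j) if i == 0 then if j == 0 then a else b else if j == 0 then c else d.
have e2 (X Y : 'M[R]_2) : X 0 0 = Y 0 0 -> X 0 1 = Y 0 1 -> X 1 0 = Y 1 0 ->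
    X 1 1 = Y 1 1 -> X = Y.
  move=> h1 h2 h3 h4; apply/matrixP => i j.
  have o2 (k : 'I_2) : k = 0 \/ k = 1.
    by case: k => [[|[|//]]] h; [left|right]; apply/val_inj.
  by case: (o2 i) => ->; case: (o2 j) => ->.
have mE (X Y : 'M[R]_2) i j : (X *m Y) i j = X i 0 * Y 0 j + X i 1 * Y 1 j.
  by rewrite mxE big_ord_recl big_ord1; congr (_ + X _ _ * Y _ _); apply/val_inj.
have skewE (Y : 'M[R]_2) : Y^T = - Y -> [/\ Y 0 0 = 0, Y 1 1 = 0 & Y 1 0 = - Y 0 1].
  move=> /matrixP h; have := h 0 0; have := h 1 1; have := h 0 1; rewrite !mxE.
  by move=> *; split=> //; lra.
case=> [sS|sS].
  have S10 : S 1 0 = S 0 1 by rewrite -[in LHS]sS mxE.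
  (* For the reflection with rows [(a, b)] and [(b, -a)], the second equation says that it commutes
     with [S]. *)
  have [a [b [ab abS]]] : exists a b : R, a ^+ 2 + b ^+ 2 = 1 /\
      (S 0 0 - S 1 1) * b = 2 * S 0 1 * a.
    move: (S 0 0 - S 1 1) (2 * S 0 1) => h f.
    have [z|nz] := eqVneq (h ^+ 2 + f ^+ 2) 0.
      (* Here [S] is scalar and any reflection works. *)
      exists 1, 0; move/eqP: z; rewrite paddr_eq0 ?sqr_ge0 // !sqrf_eq0.
      by move=> /andP[/eqP-> /eqP->]; split; ring.
    have p : 0 < h ^+ 2 + f ^+ 2 by rewrite lt0r nz addr_ge0 ?sqr_ge0.
    exists (h / Num.sqrt (h ^+ 2 + f ^+ 2)), (f / Num.sqrt (h ^+ 2 + f ^+ 2)).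
    split; last by ring.
    by rewrite !exprMn -mulrDl exprVn sqr_sqrtr ?(ltW p) // mulfV.
  exists (M2 a b b (- a)); split.
  - by apply: e2; rewrite mE !mxE /= -?ab; ring.
  - by move=> Y /skewE[h1 h2 h3]; apply: e2; rewrite mxE !mE !mxE /= ?h1 ?h2 ?h3; ring.
  - have comb x y z t : x - y = z * (a ^+ 2 + b ^+ 2 - 1) +
        t * ((S 0 0 - S 1 1) * b - 2 * S 0 1 * a) -> x = y.
      by rewrite ab abS !subrr !mulr0 addr0 => /subr0_eq.
    apply: e2; rewrite !mE !mxE /= ?S10.
    + by apply: (comb _ _ (S 0 0) (- b)); ring.
    + by apply: (comb _ _ (S 0 1) a); ring.
    + by apply: (comb _ _ (S 0 1) a); ring.
    + by apply: (comb _ _ (S 1 1) b); ring.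
have [h1 h2 h3] := skewE _ sS.
(* [S] and every skew [Y] are multiples of this matrix, whose square is minus the identity. *)
exists (M2 0 1 (-1) 0); split.
- by apply: e2; rewrite mE !mxE /=; ring.
- by move=> Y /skewE[k1 k2 k3]; apply: e2; rewrite mxE !mE !mxE /= ?k1 ?k2 ?k3; ring.
- by apply: e2; rewrite !mE !mxE /= ?h1 ?h2 ?h3; ring.
Qed.

(** * Reduction to two rows and the isometry on matrices *)

(** The kernel of [A] contains [m] orthonormal rows [N], completed by two rows [U]. Since [A]
    vanishes on [N] from both sides, inserting [U^T *m U + N^T *m N = 1] around it leaves only
    [U]. *)
Lemma exists_orthogonal_reduction {R : realType} {m : nat} (A : 'M[R]_(2 + m)) :
  (\rank A <= 2)%N -> A^T = A \/ A^T = - A ->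
  exists Q : 'M[R]_(2 + m), Q *m Q^T = 1%:M /\
    A = (usubmx Q)^T *m (usubmx Q *m A *m (usubmx Q)^T) *m usubmx Q.
Proof.
move=> rA sA.
have [|N NN /sub_kermxP NA] := exists_orthonormal_rows (kermx A) m.
  by rewrite mxrank_ker; lia.
have [|U UU /sub_kermxP UN] := exists_orthonormal_rows (kermx N^T) 2.
  by rewrite mxrank_ker; have := rank_leq_col N^T; lia.
have NU : N *m U^T = 0 by rewrite -[LHS]trmxK trmx_mul trmxK UN trmx0.
have AN : A *m N^T = 0.
  by apply: trmx_inj; rewrite trmx_mul trmxK trmx0; case: sA => ->;
    rewrite ?mulmxN NA ?oppr0.
have QQ : col_mx U N *m (col_mx U N)^T = 1%:M.
  by rewrite tr_col_mx mul_col_row UU UN NU NN -scalar_mx_block.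
exists (col_mx U N); split=> //; rewrite col_mxKu.
have := mulmx1C QQ; rewrite tr_col_mx mul_row_col => I.
rewrite -[LHS]mul1mx -I mulmxDl -!mulmxA NA mulmx0 addr0.
rewrite -[in LHS](mulmx1 A) -I mulmxDr (mulmxA A N^T) AN mul0mx addr0.
by rewrite !mulmxA.
Qed.

(** Preserving the whole matrix [X^T *m A *m X], not just a trace, lets one [phi] serve every
    [B]. *)
Lemma exists_form_isometry {R : realType} {m : nat} (A : 'M[R]_(2 + m)) :
  (\rank A <= 2)%N -> A^T = A \/ A^T = - A ->
  exists phi : 'M[R]_(2 + m) -> 'M[R]_(2 + m), linear phi /\
    forall X, X^T = - X -> [/\ (phi X)^T = phi X,
      \tr ((phi X)^T *m phi X) = \tr (X^T *m X) &
      (phi X)^T *m A *m phi X = X^T *m A *m X].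
Proof.
move=> rA sA; have [Q [QQ AE]] := exists_orthogonal_reduction A rA sA.
move: AE; set U := usubmx Q; set S := U *m A *m U^T => AE.
have sS : S^T = S \/ S^T = - S.
  rewrite /S !trmx_mul trmxK !mulmxA.
  by case: sA => ->; [left | right]; rewrite ?mulmxN ?mulNmx.
have [K [orthK symK KS]] := exists_orthogonal_twist S sS.
have Q1 := mulmx1C QQ.
exists (fun X => Q^T *m skew_to_sym K (Q *m X *m Q^T) *m Q); split=> [c X Y|X sX].
  rewrite mulmxDr mulmxDl -scalemxAr -scalemxAl skew_to_sym_linear.
  by rewrite mulmxDr mulmxDl -scalemxAr -scalemxAl.
have sY : (Q *m X *m Q^T)^T = - (Q *m X *m Q^T).
  by rewrite !trmx_mul trmxK sX mulNmx mulmxN mulmxA.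
split.
- by rewrite !trmx_mul trmxK trmx_skew_to_sym // mulmxA.
- rewrite !trmx_mul trmxK !mulmxA -(mulmxA _ Q Q^T) QQ mulmx1.
  rewrite mxtrace_mulC !mulmxA QQ mul1mx norm_skew_to_sym //.
  rewrite !trmx_mul trmxK !mulmxA -(mulmxA _ Q^T Q) Q1 mulmx1.
  by rewrite mxtrace_mulC !mulmxA Q1 mul1mx.
(* [A] sees a matrix only through its product with [U], and there [phi] acts as [K]. *)
have UP : U *m (Q^T *m skew_to_sym K (Q *m X *m Q^T) *m Q) = K *m (U *m X).
  rewrite /U !mul_usub_mx !mulmxA QQ mul1mx -mul_usub_mx usubmx_skew_to_sym.
  by rewrite -!mul_usub_mx -!mulmxA Q1 mulmx1.
have AU (Z : 'M[R]_(2 + m)) : Z^T *m A *m Z = (U *m Z)^T *m S *m (U *m Z).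
  by rewrite AE trmx_mul !mulmxA.
by rewrite !AU UP trmx_mul -[in RHS]KS !mulmxA.
Qed.

(** * Vectorisation, dimensions and the Kronecker form *)

Lemma dot_vec {R : realType} {n : nat} (X Y : 'M[R]_n) :
  ((vec X)^T *m vec Y) 0 0 = \tr (X^T *m Y).
Proof.
rewrite mxE (reindex (@mxtens_index n n)) /=; last first.
  by exists (@mxtens_unindex n n) => i _; rewrite (mxtens_indexK, mxtens_unindexK).
under eq_bigr do rewrite !mxE mxtens_indexK /=.
by rewrite mxtrace_tr_mulmx pair_bigA /=; apply: eq_bigr => - [].
Qed.

Lemma kron_vec {R : realType} {n : nat} (A B X : 'M[R]_n) :
  (A *t B) *m vec X = vec (B *m X *m A^T).
Proof.
apply/colP => k; case: (mxtens_indexP k) => j i.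
rewrite !mxE mxtens_indexK /= (reindex (@mxtens_index n n)) /=; last first.
  by exists (@mxtens_unindex n n) => l _; rewrite (mxtens_indexK, mxtens_unindexK).
under [RHS]eq_bigr do rewrite !mxE mulr_suml.
rewrite pair_bigA /=; apply: eq_bigr => - [a b] _.
by rewrite !mxE !mxtens_indexK /=; ring.
Qed.

Definition unvec {R : realType} {n : nat} (x : 'rV[R]_(n * n)) : 'M[R]_n :=
  \matrix_(i, j) x 0 (mxtens_index (j, i)).

Lemma unvecK {R : realType} {n : nat} (x : 'rV[R]_(n * n)) : (vec (unvec x))^T = x.
Proof.
by apply/rowP => k; case: (mxtens_indexP k) => i j; rewrite !mxE mxtens_indexK.
Qed.

Lemma vec_inj {R : realType} {n : nat} : injective (@vec R n).
Proof.
move=> X Y /colP h; apply/matrixP => i j.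
by have := h (mxtens_index (j, i)); rewrite !mxE mxtens_indexK.
Qed.

Lemma even_space_vec {R : realType} {n : nat} (X : 'M[R]_n) :
  ((vec X)^T <= even_space R n)%MS <-> X^T = X.
Proof.
split=> [/even_spaceP|h]; last by apply/even_spaceP; rewrite commutation_mx_vec h.
by rewrite commutation_mx_vec => /vec_inj.
Qed.

Lemma odd_space_vec {R : realType} {n : nat} (X : 'M[R]_n) :
  ((vec X)^T <= odd_space R n)%MS <-> X^T = - X.
Proof.
have vN : vec (- X) = - vec X by apply/colP => k; rewrite !mxE.
split=> [/odd_spaceP|h].
  by rewrite commutation_mx_vec -vN => /vec_inj.
by apply/odd_spaceP; rewrite commutation_mx_vec h vN.
Qed.

(* With half_sum_square, this forces the ranks of both spaces to be the numbers of
   even and odd eigenvalues. *)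
Lemma mxrank_even_odd {R : realType} (n : nat) :
  (\rank (even_space R n) + \rank (odd_space R n) <= n * n)%N.
Proof.
rewrite -mxrank_sum_cap; have -> : (even_space R n :&: odd_space R n)%MS = 0.
  apply/eqP; rewrite -submx0; apply/rV_subP => x; rewrite -(unvecK x) sub_capmx.
  move=> /andP[/even_space_vec h1 /odd_space_vec h2].
  have v0 : vec (0 : 'M[R]_n) = 0 by apply/colP => k; rewrite !mxE.
  suff -> : unvec x = 0 by rewrite v0 trmx0 sub0mx.
  apply/matrixP => i j; have /matrixP/(_ i j) := etrans (esym h1) h2.
  by rewrite !mxE => ?; lra.
by rewrite mxrank0 addn0 rank_leq_col.
Qed.

Lemma half_sum_square (n : nat) : ((n * n.+1)./2 + (n * n.-1)./2 = n * n)%N.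
Proof.
case: n => [//|k]; rewrite -[k.+1.-1]/k.
have -> : (k.+1 * k.+2 = k.+1 * k + k.+1.*2)%N by lia.
have e : ~~ odd (k.+1 * k) by rewrite oddM /= andNb.
rewrite halfD (negPf e) odd_double /= doubleK.
by rewrite add0n addnAC addnn even_halfK //; lia.
Qed.

(** With the always true predicate, the length is the rank of a subspace of [V]. *)
Lemma size_eigenvalues_on_le {R : realType} {m p : nat} (M : 'M[R]_m)
    (V : 'M[R]_(p, m)) :
  (size (eigenvalues_on M V) <= \rank V)%N.
Proof. by rewrite -count_predT -mxrank_eigensum mxrankS ?eigensum_sub. Qed.

(** The two Kronecker terms contribute equal traces, by transposition and cyclicity; [X] occurs
    twice, so the sign cancels. *)
Lemma kron_form {R : realType} {n : nat} (A B X : 'M[R]_n) :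
  X^T = X \/ X^T = - X ->
  ((vec X)^T *m (A *t B + B *t A) *m (vec X)^T^T) 0 0
    = 2 * \tr (X^T *m A *m X *m B^T).
Proof.
move=> sX; rewrite trmxK -mulmxA mulmxDl !kron_vec mulmxDr mxE !dot_vec.
suff -> : \tr (X^T *m (B *m X *m A^T)) = \tr (X^T *m (A *m X *m B^T)).
  by rewrite !mulmxA; ring.
rewrite -mxtrace_tr !trmx_mul !trmxK !mulmxA mxtrace_mulC !mulmxA.
by case: sX => ->; rewrite ?(mulmxN, mulNmx).
Qed.

(** * Interlacing when one factor has rank at most 2 *)

Lemma odd_interlace_even_rank2 {R : realType} {n : nat} (A B : 'M[R]_n) :
  (\rank A <= 2)%N ->
  (A^T = A /\ B^T = B) \/ (A^T = - A /\ B^T = - B) ->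
  odd_interlace_even (A *t B + B *t A).
Proof.
(* For [n] at most 1 there are no odd eigenvalues. *)
case: n A B => [|[|m]] A B rA sAB; [by move=> i | by move=> i | ].
have sA : A^T = A \/ A^T = - A by case: sAB => -[]; [left | right].
have [phi [lphi phiP]] := @exists_form_isometry R m A rA sA.
have symC := trmx_kron_sym sAB; have TC := commutation_kron_sym A B.
set C := _ + _ in symC TC *.
have sV := size_even_eigenvalues symC TC; have sW := size_odd_eigenvalues symC TC.
have := half_sum_square m.+2; have := mxrank_even_odd (R := R) m.+2.
have := size_eigenvalues_on_le C (even_space R m.+2); rewrite [size _]sV.
have := size_eigenvalues_on_le C (odd_space R m.+2); rewrite [size _]sW.
move=> h1 h2 h3 h4.
(* List lengths are at most the ranks, yet sum to [n * n], which bounds the sum of the ranks; so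
   equality holds. *)
have rV : ((m.+2 * m.+3)./2 = \rank (even_space R m.+2))%N by lia.
have rW : ((m.+2 * m.+2.-1)./2 = \rank (odd_space R m.+2))%N by lia.
(* [phi] carried over to row vectors through [vec]. *)
have [F FE] : exists F : 'M[R]_(m.+2 * m.+2),
    forall u, (vec (phi (unvec u)))^T = u *m F.
  apply: linear_mx => c u v.
  have -> : unvec (c *: u + v) = c *: unvec u + unvec v.
    by apply/matrixP => i j; rewrite !mxE.
  by rewrite lphi; apply/rowP => k; rewrite !mxE.
have FW (x : 'rV[R]_(m.+2 * m.+2)) :
    (x <= odd_space R m.+2)%MS -> (unvec x)^T = - unvec x.
  by rewrite -{1}(unvecK x) => /odd_space_vec.
rewrite /odd_interlace_even rV rW => i iW.
apply: (interlace_isometric_embedding C _ _ F) => //.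
- apply/rV_subP => y /submxP[z ->]; rewrite mulmxA -FE; apply/even_space_vec.
  by have [] := phiP _ (FW _ (submxMl z _)).
- move=> x /FW xW; have [_ h _] := phiP _ xW.
  by rewrite -FE trmxK dot_vec h -dot_vec unvecK -[vec _]trmxK unvecK.
- move=> x /FW xW; have [s _ h] := phiP _ xW.
  rewrite -FE kron_form; last by left.
  by rewrite h -kron_form; [rewrite unvecK|right].
- by rewrite -rV -sV.
- by rewrite -rW -sW.
- by rewrite -rV -rW half_leq // leq_mul2l; lia.
Qed.

Theorem theorem4 (R : realType) (n : nat) (A B : 'M[R]_n)
    (hrank : (minn (\rank A) (\rank B) <= 2)%N)
    (hcase : (A^T = A /\ B^T = B) \/ (A^T = - A /\ B^T = - B)) :
  odd_interlace_even (A *t B + B *t A).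
Proof.
move: hrank; rewrite geq_min => /orP[rA|rB].
  exact: odd_interlace_even_rank2.
rewrite addrC; apply: odd_interlace_even_rank2 => //.
by case: hcase => -[]; [left | right].
Qed.
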